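(* Let $X$ be an Hadamard space and $T$ a metrically nonspreading mapping of $X$ into itself such that $\mathcal{F}(T)$ is nonempty. Then, for all $x\in X$, the sequence $\{T^n x\}$ is $\Delta$-convergent to an element of $\mathcal{F}(T)$.
   Context: $\mathcal{F}(T)=\{u\in X : Tu=u\}$ denotes the set of all fixed points of $T$. A mapping $T$ of a metric space $(X,d)$ into itself is metrically nonspreading if $2d(Tx,Ty)^2 \leq d(Tx,y)^2 + d(Ty,x)^2$ for all $x,y\in X$. The asymptotic center of a sequence $\{x_n\}$ in $X$ is $\mathcal{A}(\{x_n\})=\{u\in X : \limsup_n d(u,x_n)=\inf_{y\in X}\limsup_n d(y,x_n)\}$, where upper limits are taken in $[0,\infty]$. The sequence $\{x_n\}$ is $\Delta$-convergent to $p\in X$ if $\mathcal{A}(\{x_{n_i}\})=\{p\}$ for each subsequence $\{x_{n_i}\}$ of $\{x_n\}$. A metric space $X$ is uniquely geodesic if for all $x,y\in X$ there is a unique mapping $\gamma\colon[0,l]\to X$, $l=d(x,y)$, with $\gamma(0)=x$, $\gamma(l)=y$ and $d(\gamma(s),\gamma(t))=|s-t|$ for all $s,t\in[0,l]$; the point $\gamma(\alpha l)$ is denoted by $(1-\alpha)x\oplus\alpha y$ for $\alpha\in[0,1]$. A $\mathrm{CAT}(0)$ space is a uniquely geodesic metric space such that $d((1-\alpha)x\oplus\alpha y,(1-\beta)x\oplus\beta z)\leq |(1-\alpha)\bar x+\alpha\bar y-((1-\beta)\bar x+\beta\bar z)|_{\mathbb{R}^2}$ whenever $x,y,z\in X$,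 $\alpha,\beta\in[0,1]$ and $\bar x,\bar y,\bar z\in\mathbb{R}^2$ satisfy $d(x,y)=|\bar x-\bar y|_{\mathbb{R}^2}$, $d(y,z)=|\bar y-\bar z|_{\mathbb{R}^2}$, $d(z,x)=|\bar z-\bar x|_{\mathbb{R}^2}$, where $|\cdot|_{\mathbb{R}^2}$ is the Euclidean norm. An Hadamard space is a complete $\mathrm{CAT}(0)$ space. *)

(* Defs.v *)
From HB Require Import structures.
From mathcomp Require Import all_boot all_order all_algebra.
From mathcomp Require Import all_classical all_reals all_analysis.

Set Implicit Arguments.
Unset Strict Implicit.
Unset Printing Implicit Defensive.

Import Order.TTheory GRing.Theory Num.Theory.

Local Open Scope classical_set_scope.
Local Open Scope ring_scope.

Definition fixed_points (X : Type) (T : X -> X) : set X := [set u | T u = u].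

(* The library's norm on row vectors is the sup norm, hence this definition. *)
Definition eucl_norm (R : realType) (n : nat) (v : 'rV[R]_n) : R :=
  Num.sqrt (\sum_(i < n) v ord0 i ^+ 2).

Section MetricSpace.
Context {R : realType} {X : metricType R}.
Implicit Types (x y u p : X) (s : nat -> X) (T : X -> X).

Definition metrically_nonspreading T : Prop :=
  forall x y, 2 * mdist (T x) (T y) ^+ 2
              <= mdist (T x) y ^+ 2 + mdist (T y) x ^+ 2.

Definition asymptotic_radius s y : \bar R :=
  limn_esup (fun n => (mdist y (s n))%:E).

Definition asymptotic_center s : set X :=
  [set u | asymptotic_radius s u = ereal_inf (range (asymptotic_radius s))].

Definition delta_cvg s p : Prop :=
  forall phi : nat -> nat, increasing_seq phi ->
    asymptotic_center (s \o phi) = [set p].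

(* A map [0, l] -> X, with l = mdist x y, is represented by a function on R;
   its values outside [0, l] are irrelevant. *)
Definition is_geodesic x y (g : R -> X) : Prop :=
  [/\ g 0 = x, g (mdist x y) = y &
      {in `[0, mdist x y] &, forall a b, mdist (g a) (g b) = `|a - b|}].

(* The point (1 - a) x (+) a y; the default value x of xget is used only when
   x and y are joined by no geodesic. *)
Definition geod_comb x y (a : R) : X :=
  xget x [set g (a * mdist x y) | g in is_geodesic x y].

End MetricSpace.

Definition uniquely_geodesic (R : realType) (X : metricType R) : Prop :=
  forall x y : X, exists g : R -> X, is_geodesic x y g /\
    forall h : R -> X, is_geodesic x y h -> {in `[0, mdist x y], h =1 g}.

Lemma geod_combE (R : realType) (X : metricType R) (x y : X) (g : R -> X)
    (a : R) :
  uniquely_geodesic X -> is_geodesic x y g -> a \in `[0, 1] ->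
  geod_comb x y a = g (a * mdist x y).
Proof.
move=> /(_ x y)[k [_ kuniq]] gxy; rewrite in_itv/= => /andP[a0 a1].
have al : a * mdist x y \in `[0, mdist x y].
  by rewrite in_itv/= mulr_ge0 ?mdist_ge0//= ler_piMl ?mdist_ge0.
rewrite /geod_comb; case: xgetP => [_ -> [h hxy <-]|]; last first.
  by move=> /(_ (g (a * mdist x y))) []; exists g.
by rewrite (kuniq _ hxy)// (kuniq _ gxy).
Qed.

Definition CAT0 (R : realType) (X : metricType R) : Prop :=
  uniquely_geodesic X /\
  forall (x y z : X) (a b : R) (x' y' z' : 'rV[R]_2),
    a \in `[0, 1] -> b \in `[0, 1] ->
    mdist x y = eucl_norm (x' - y') ->
    mdist y z = eucl_norm (y' - z') ->
    mdist z x = eucl_norm (z' - x') ->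
    mdist (geod_comb x y a) (geod_comb x z b)
    <= eucl_norm (((1 - a) *: x' + a *: y') - ((1 - b) *: x' + b *: z')).

(* The library's completeType would require X to be pointed. *)
Definition complete_metric (R : realType) (X : metricType R) : Prop :=
  forall s : nat -> X, cauchy (s @ \oo) -> exists p : X, s @ \oo --> p.

Definition Hadamard (R : realType) (X : metricType R) : Prop :=
  complete_metric X /\ CAT0 X.

(* Main.v *)
Require Import Defs.
From mathcomp Require Import all_boot all_order all_algebra.
From mathcomp Require Import ring lra.
From mathcomp Require Import all_classical all_reals all_analysis.

Local Open Scope classical_set_scope.

(** Write x_n for T^n x and L(y) for the upper limit of d(y, s_n)^2 along a
bounded sequence s.  Everything rests on working with squared distances, because
both the hypothesis on T and the geometry of X are statements about squares.

Geometry: comparison with a Euclidean triangle gives the inequality of Bruhat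
and Tits (CAT0_CN), and it passes to upper limits: if m is the midpoint of x and
y, then 2 L(m) + d(x,y)^2 / 2 <= L(x) + L(y).  Hence minimizers of L are unique
and minimizing sequences are Cauchy, so that in an Hadamard space every bounded
sequence has exactly one asymptotic center.

Dynamics: let D_k be the upper limit over n of d(x_n, x_(n+k))^2.  Applying the
nonspreading inequality to x_n and x_(n+k+1) gives 2 D_(k+1) <= D_k + D_(k+2),
that is, D is convex in k.  It is bounded, since the distances from x_n to a
fixed point of T do not increase, and D_0 = 0.  A bounded convex sequence on the
natural numbers cannot increase, so D_1 <= 0: the orbit is asymptotically regular
(iter_asymptotically_regular).

Asymptotic regularity makes the upper limits along s and along T o s equal, for
any subsequence s of the orbit.  The nonspreading inequality at z and s_n then
reads 2 L(T z) <= L(z) + L(T z), so L(T z) <= L(z), and the asymptotic center z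
of s is a fixed point by uniqueness (regular_asymptotic_center_fixed).

Finally d(x_n, p) is monotone, hence convergent, for every fixed point p; so L(p)
is the same for the orbit and for all its subsequences.  The centers of the
orbit and of a subsequence, both being fixed points, therefore minimize the same
values and coincide. *)

Section proof.
Import Order.TTheory GRing.Theory Num.Theory.
Import numFieldNormedType.Exports.
Local Open Scope ring_scope.

(** * Upper limits of bounded sequences *)

Lemma bounded_fun_itv (R : realType) (u : nat -> R) (M : R) :
  (forall n, 0 <= u n <= M) -> bounded_fun (u : nat -> R^o).
Proof.
move=> uM; exists M; split; first exact: num_real.
move=> x Mx n _ /=; have /andP[u0 uMn] := uM n.
by rewrite ger0_norm// (le_trans uMn)// ltW.
Qed.

(** With [limn_sup_le_near], this characterizes the upper limit by eventual
bounds, a form in which inequalities between sequences pass to the limit. *)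
Lemma limn_sup_near_lt (R : realType) (u : nat -> R) (c : R) :
  bounded_fun (u : nat -> R^o) -> limn_sup u < c -> \forall n \near \oo, u n < c.
Proof.
move=> bu; rewrite limn_supE// => /inf_lt[|_ [n _ <-] snc].
  by exists (sups u 0); exists 0%N.
exists n => // m /= nm; apply: le_lt_trans snc.
apply: ub_le_sup; last by exists m.
exact/has_ubound_sdrop/bounded_fun_has_ubound.
Qed.

Lemma limn_sup_le_near (R : realType) (u : nat -> R) (c : R) :
  bounded_fun (u : nat -> R^o) -> (\forall n \near \oo, u n <= c) ->
  limn_sup u <= c.
Proof.
move=> bu [N _ uc]; rewrite limn_supE//.
apply: (@le_trans _ _ (sups u N)).
  by apply: ge_inf; [exact: bounded_fun_has_lbound_sups|exists N].
by apply: ge_sup => [|_ [n /= Nn <-]]; [exists (u N); exists N => /=|exact: uc].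
Qed.

(** Subadditivity of upper limits, in the shape shared by the midpoint inequality
of the space and by the nonspreading inequality. *)
Lemma limn_sup_midpoint (R : realType) (u v w : nat -> R) (q : R) :
  bounded_fun (u : nat -> R^o) -> bounded_fun (v : nat -> R^o) ->
  bounded_fun (w : nat -> R^o) ->
  (\forall n \near \oo, 2 * u n + q <= v n + w n) ->
  2 * limn_sup u + q <= limn_sup v + limn_sup w.
Proof.
move=> bu bv bw uvw; apply/ler_addgt0Pr => e e0.
suff : limn_sup u <= (limn_sup v + limn_sup w + e - q) / 2 by lra.
apply: limn_sup_le_near => //.
have e20 : 0 < e / 2 by rewrite divr_gt0.
have := limn_sup_near_lt _ v (limn_sup v + e / 2) bv ltac:(lra).
have := limn_sup_near_lt _ w (limn_sup w + e / 2) bw ltac:(lra).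
by apply: filterS3 uvw => n; lra.
Qed.

Lemma limn_sup_shift (R : realType) (u : nat -> R) :
  bounded_fun (u : nat -> R^o) -> limn_sup (fun n => u n.+1) = limn_sup u.
Proof.
move=> bu; have buS : bounded_fun (fun n => u n.+1 : R^o).
  by case: bu => M [Mr uM]; exists M; split=> // x Mx n _; exact: uM.
have shift c : (\forall n \near \oo, u n.+1 <= c) <-> (\forall n \near \oo, u n <= c).
  split=> -[N _ uc]; last by exists N => // n /= Nn; apply: uc => /=; exact: leqW.
  by exists N.+1 => // -[//|n] /= Nn; exact: uc.
apply/eqP; rewrite eq_le; apply/andP; split; apply/ler_addgt0Pr => e e0;
  apply: limn_sup_le_near => //; apply/shift.
- by apply: filterS (limn_sup_near_lt _ _ _ bu _); [move=> n /ltW; exact|rewrite ltrDl].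
- by apply: filterS (limn_sup_near_lt _ _ _ buS _); [move=> n /ltW; exact|rewrite ltrDl].
Qed.

(** Convexity makes the increments of D nondecreasing, so D k >= k * D 1; a
positive first increment would contradict boundedness. *)
Lemma convex_bounded_step0 (R : realType) (D : nat -> R) (M : R) :
  D 0%N = 0 -> (forall k, 2 * D k.+1 <= D k + D k.+2) -> (forall k, D k <= M) ->
  D 1%N <= 0.
Proof.
move=> D0 Dconvex DM; rewrite leNgt; apply/negP => D1.
have Dstep k : D 1%N <= D k.+1 - D k.
  by elim: k => [|k IH]; [rewrite D0 subr0|have := Dconvex k; lra].
have Dlin k : k%:R * D 1%N <= D k.
  elim: k => [|k IH]; first by rewrite mul0r D0.
  by have := Dstep k; rewrite -natr1 mulrDl mul1r; lra.
have := truncnS_gt (M / D 1%N); set k := (Num.trunc _).+1.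
by rewrite ltr_pdivrMr// ltNge (le_trans (Dlin k)).
Qed.

Lemma limn_esup_near_lt (R : realType) (u : nat -> \bar R) (c : \bar R) :
  (limn_esup u < c)%E -> \forall n \near \oo, (u n < c)%E.
Proof.
move=> /ereal_inf_lt[_ [V Voo <-] Vc]; apply: filterS Voo => n Vn.
by apply: le_lt_trans Vc; apply: ereal_sup_ubound; exists n.
Qed.

Lemma limn_esup_le_near (R : realType) (u : nat -> \bar R) (c : \bar R) :
  (\forall n \near \oo, (u n <= c)%E) -> (limn_esup u <= c)%E.
Proof.
move=> uc; apply: (@le_trans _ _ (ereal_sup (u @` [set n | (u n <= c)%E]))).
  by apply: ereal_inf_lbound; exists [set n | (u n <= c)%E].
by apply: ge_ereal_sup => _ [n /= unc <-].
Qed.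

(** * Asymptotic centers as minimizers of a squared radius *)

Section AsymptoticCenter.
Context {R : realType} {X : metricType R}.
Implicit Types (x y z : X) (s : nat -> X).

Definition metric_bounded s := exists y M, forall n, mdist y (s n) <= M.

(** The real counterpart of the square of [asymptotic_radius], to which it is
related by [asymptotic_radiusE] when the sequence is bounded. *)
Definition sq_radius s y : R := limn_sup (fun n => mdist y (s n) ^+ 2).

Lemma metric_bounded_sub s (phi : nat -> nat) :
  metric_bounded s -> metric_bounded (s \o phi).
Proof. by move=> [y [M yM]]; exists y, M => n /=. Qed.

Lemma bounded_fun_sq_mdist s y :
  metric_bounded s -> bounded_fun (fun n => mdist y (s n) ^+ 2 : R^o).
Proof.
move=> [z [M zM]]; apply: (@bounded_fun_itv _ _ ((mdist y z + M) ^+ 2)) => n.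
have M0 : 0 <= M by rewrite (le_trans _ (zM n)) ?mdist_ge0.
rewrite sqr_ge0/= lerXn2r ?nnegrE ?addr_ge0 ?mdist_ge0//.
by rewrite (le_trans (metric_triangle _ z _))// lerD2l.
Qed.

Lemma sq_radius_near_lt s y (c : R) : metric_bounded s -> 0 <= c ->
  sq_radius s y < c ^+ 2 -> \forall n \near \oo, mdist y (s n) < c.
Proof.
move=> bs c0 /(limn_sup_near_lt _ _ _ (bounded_fun_sq_mdist _ y bs)).
by apply: filterS => n; rewrite ltr_pXn2r// ?nnegrE ?mdist_ge0.
Qed.

Lemma sq_radius_le_near s y (c : R) : metric_bounded s ->
  (\forall n \near \oo, mdist y (s n) <= c) -> sq_radius s y <= c ^+ 2.
Proof.
move=> bs yc; apply: limn_sup_le_near; first exact: bounded_fun_sq_mdist.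
apply: filterS yc => n yc.
by rewrite lerXn2r// nnegrE ?mdist_ge0// (le_trans _ yc) ?mdist_ge0.
Qed.

Lemma sq_radius_ge0 s y : metric_bounded s -> 0 <= sq_radius s y.
Proof.
move=> bs; apply/ler_addgt0Pr => e e0.
rewrite leNgt; apply/negP => se.
have sn : sq_radius s y < 0 by lra.
have [N _ /(_ N (leqnn N))] := limn_sup_near_lt _ _ _ (bounded_fun_sq_mdist _ y bs) sn.
by rewrite ltNge sqr_ge0.
Qed.

Lemma asymptotic_radiusE s y : metric_bounded s ->
  asymptotic_radius s y = (Num.sqrt (sq_radius s y))%:E.
Proof.
move=> bs; apply/eqP; rewrite eq_le; apply/andP; split.
  apply/lee_addgt0Pr => e e0; rewrite -EFinD; apply: limn_esup_le_near.
  have r0 : 0 <= Num.sqrt (sq_radius s y) by exact: sqrtr_ge0.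
  have := sq_radius_near_lt s y (Num.sqrt (sq_radius s y) + e) bs.
  rewrite addr_ge0 ?(ltW e0)// => /(_ isT).
  rewrite -[X in X < _ -> _]sqr_sqrtr ?sq_radius_ge0// ltr_pXn2r ?nnegrE ?addr_ge0 ?(ltW e0)//.
  rewrite ltrDl e0 => /(_ isT); apply: filterS => n.
  by rewrite lee_fin => /ltW.
have le_c (c : R) : (asymptotic_radius s y < c%:E)%E -> Num.sqrt (sq_radius s y) <= c.
  move=> /limn_esup_near_lt yc.
  have c0 : 0 <= c.
    by case: yc => N _ /(_ N (leqnn N)); rewrite lte_fin => /ltW; exact/le_trans/mdist_ge0.
  rewrite -[leRHS](ger0_norm c0) -(sqrtr_sqr c) ler_sqrt ?sqr_ge0//.
  apply: sq_radius_le_near => //.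
  by apply: filterS yc => n; rewrite lte_fin => /ltW.
case: (asymptotic_radius s y) le_c => [r| |] le_c; last 2 first.
- by rewrite leey.
- by have := le_c (Num.sqrt (sq_radius s y) - 1) (ltNyr _); rewrite lerBrDl gerDr ler10.
by rewrite lee_fin; apply/ler_addgt0Pr => e e0; apply: le_c; rewrite lte_fin ltrDl.
Qed.

(** The square root is increasing, so the radius and its square have the same
minimizers. *)
Lemma asymptotic_centerE s u : metric_bounded s ->
  asymptotic_center s u <-> forall y, sq_radius s u <= sq_radius s y.
Proof.
move=> bs; have radE y z : (asymptotic_radius s y <= asymptotic_radius s z)%E =
    (sq_radius s y <= sq_radius s z).
  by rewrite !asymptotic_radiusE// lee_fin ler_sqrt// sq_radius_ge0.
split=> [su y|su]; first by rewrite -radE su; apply: ereal_inf_lbound; exists y.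
apply/eqP; rewrite eq_le; apply/andP; split.
  by apply: le_ereal_inf_tmp => _ [y _ <-]; rewrite radE.
by apply: ereal_inf_lbound; exists u.
Qed.

End AsymptoticCenter.

(** * Comparison triangles and the Bruhat-Tits inequality *)

Section Comparison.
Context {R : realType}.

Definition vec2 (a b : R) : 'rV[R]_2 := \row_i (if i == 0 then a else b).

Lemma eucl_norm_vec2 (a b : R) : eucl_norm (vec2 a b) = Num.sqrt (a ^+ 2 + b ^+ 2).
Proof. by rewrite /eucl_norm !big_ord_recl big_ord0 !mxE/= addr0. Qed.

Lemma vec2B (a b c d : R) : vec2 a b - vec2 c d = vec2 (a - c) (b - d).
Proof. by apply/rowP => i; rewrite !mxE; case: ifP. Qed.

Lemma vec2_comb (a b c d k l : R) :
  k *: vec2 a b + l *: vec2 c d = vec2 (k * a + l * c) (k * b + l * d).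
Proof. by apply/rowP => i; rewrite !mxE; case: ifP. Qed.

(** The three sides a, b, c are those of the triangle with vertices (0, 0), (c, 0)
and (u, v).  The law of cosines dictates u, and b^2 - u^2 >= 0 is Heron's
formula: 4 c^2 (b^2 - u^2) is the product of the four signed sums of sides. *)
Lemma comparison_triangle (a b c : R) : 0 <= a -> 0 <= b -> 0 <= c ->
  a <= b + c -> b <= a + c -> c <= a + b ->
  exists u v : R, u ^+ 2 + v ^+ 2 = b ^+ 2 /\ (c - u) ^+ 2 + v ^+ 2 = a ^+ 2.
Proof.
(* If c = 0, the law of cosines leaves u undetermined. *)
move=> a0 b0 c0 abc bac cab; have [c_eq0|c_neq0] := eqVneq c 0.
  have -> : a = b by lra.
  by exists b, 0; rewrite c_eq0; split; ring.
have c_gt0 : 0 < c by rewrite lt_neqAle eq_sym c_neq0.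
pose u := (b ^+ 2 + c ^+ 2 - a ^+ 2) / (2 * c).
have uc : 2 * c * u = b ^+ 2 + c ^+ 2 - a ^+ 2.
  by rewrite /u; field.
have ub : 0 <= b ^+ 2 - u ^+ 2.
  have : 0 <= (2 * c) ^+ 2 * (b ^+ 2 - u ^+ 2).
    have -> : (2 * c) ^+ 2 * (b ^+ 2 - u ^+ 2) =
        (a + c - b) * (a + b - c) * ((b + c - a) * (b + c + a)).
      by rewrite mulrBr -!exprMn uc; ring.
    by rewrite !mulr_ge0//; lra.
  by rewrite pmulr_rge0// exprn_gt0// mulr_gt0.
clearbody u; exists u, (Num.sqrt (b ^+ 2 - u ^+ 2)); rewrite sqr_sqrtr//; split; first by ring.
rewrite (_ : (c - u) ^+ 2 = c ^+ 2 - 2 * c * u + u ^+ 2); last by ring.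
by rewrite uc; ring.
Qed.

End Comparison.

Section Hadamard.
Context {R : realType} {X : metricType R}.
Implicit Types (x y z : X) (s : nat -> X).

Lemma geod_comb1 x z : uniquely_geodesic X -> geod_comb x z 1 = z.
Proof.
move=> ugX; have [g [gxz _]] := ugX x z.
rewrite (geod_combE ugX gxz) ?mul1r; last by rewrite in_itv/= ler01 lexx.
by case: gxz.
Qed.

(** The inequality of Bruhat and Tits.  In the plane it is an equality, the
parallelogram law; the comparison axiom with parameters 1/2 and 1 bounds the
median from z by the Euclidean one. *)
Lemma CAT0_CN x y z : CAT0 X ->
  2 * mdist z (geod_comb x y (1 / 2)) ^+ 2 + mdist x y ^+ 2 / 2 <=
  mdist z x ^+ 2 + mdist z y ^+ 2.
Proof.
move=> [ugX cat].
have txyz := metric_triangle x z y; have tyxz := metric_triangle y x z.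
have tzyx := metric_triangle z y x.
rewrite ?(metric_sym y x) ?(metric_sym z y) ?(metric_sym x z) in txyz tyxz tzyx.
have [u [v [ub ua]]] := @comparison_triangle R (mdist y z) (mdist z x) (mdist x y)
  (mdist_ge0 _ _) (mdist_ge0 _ _) (mdist_ge0 _ _)
  ltac:(lra) ltac:(lra) ltac:(lra).
have half : (1 / 2 : R) \in `[0, 1] by rewrite in_itv/=; lra.
have := cat x y z (1 / 2) 1 (vec2 0 0) (vec2 (mdist x y) 0) (vec2 u v) half.
rewrite !vec2_comb !vec2B !eucl_norm_vec2 geod_comb1//.
rewrite in_itv/= ler01 lexx => /(_ isT).
have -> : (0 - mdist x y) ^+ 2 + (0 - 0) ^+ 2 = mdist x y ^+ 2 by ring.
have -> : (mdist x y - u) ^+ 2 + (0 - v) ^+ 2 = mdist y z ^+ 2 by rewrite -ua; ring.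
have -> : (u - 0) ^+ 2 + (v - 0) ^+ 2 = mdist z x ^+ 2 by rewrite -ub; ring.
rewrite !sqrtr_sqr !ger0_norm ?mdist_ge0// => /(_ erefl erefl erefl).
rewrite metric_sym.
rewrite -(@ler_pXn2r _ 2)// ?nnegrE ?mdist_ge0 ?sqrtr_ge0// sqr_sqrtr; last first.
  by rewrite addr_ge0 ?sqr_ge0.
rewrite (metric_sym z y).
nra.
Qed.

(** * Existence and uniqueness of asymptotic centers *)

Lemma sq_radius_midpoint s x y : CAT0 X -> metric_bounded s ->
  2 * sq_radius s (geod_comb x y (1 / 2)) + mdist x y ^+ 2 / 2 <=
  sq_radius s x + sq_radius s y.
Proof.
move=> cat bs; apply: limn_sup_midpoint; [exact: bounded_fun_sq_mdist..|].
apply: nearW => n; rewrite !(metric_sym _ (s n)); exact: CAT0_CN.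
Qed.

Lemma asymptotic_center_unique s x y : CAT0 X -> metric_bounded s ->
  asymptotic_center s x -> asymptotic_center s y -> x = y.
Proof.
move=> cat bs /(asymptotic_centerE _ _ bs) sx /(asymptotic_centerE _ _ bs) sy.
apply: mdist_positivity; apply/eqP; rewrite -sqrf_eq0 eq_le sqr_ge0 andbT.
have := sq_radius_midpoint s x y cat bs.
have := sx (geod_comb x y (1 / 2)); have := sy (geod_comb x y (1 / 2)); lra.
Qed.

(** A minimizing sequence is Cauchy by the midpoint inequality.  Its limit is a
minimizer because the square root of the squared radius is 1-Lipschitz. *)
Lemma asymptotic_center_nonempty s : Hadamard X -> metric_bounded s ->
  asymptotic_center s !=set0.
Proof.
move=> [completeX cat] bs.
have [y0 _] := bs.
pose r := inf (range (sq_radius s)).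
have hi : has_inf (range (sq_radius s)).
  split; first by exists (sq_radius s y0), y0.
  by exists 0 => _ [y _ <-]; exact: sq_radius_ge0.
have r_le y : r <= sq_radius s y by apply: ge_inf; [case: hi|exists y].
have r0 : 0 <= r.
  apply: lb_le_inf; first by case: hi.
  by move=> _ [y _ <-]; exact: sq_radius_ge0.
have /choice[y yP] (n : nat) : exists y, sq_radius s y < r + n.+1%:R^-1.
  have n0 : 0 < n.+1%:R^-1 :> R by rewrite invr_gt0.
  by have [_ [y _ <-] ?] := inf_adherent n0 hi; exists y.
have y_near (e : R) : 0 < e -> \forall n \near \oo, sq_radius s (y n) < r + e.
  move=> e0; have := near_infty_natSinv_lt (PosNum e0).
  by apply: filterS => n /= ne; rewrite (lt_trans (yP n))// ltrD2l.
have : cauchy (y @ \oo).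
  apply/cauchy_ballP => e e0; near_simpl.
  have e4 : 0 < e ^+ 2 / 4 by rewrite divr_gt0// exprn_gt0.
  near=> a b => /=; rewrite ballEmdist/=.
  rewrite -(@ltr_pXn2r _ 2)// ?nnegrE ?mdist_ge0 ?(ltW e0)//.
  have ya : sq_radius s (y a) < r + e ^+ 2 / 4 by near: a; exact: y_near.
  have yb : sq_radius s (y b) < r + e ^+ 2 / 4 by near: b; exact: y_near.
  have := sq_radius_midpoint s (y a) (y b) cat bs.
  have := r_le (geod_comb (y a) (y b) (1 / 2)); lra.
move=> /completeX[p yp]; exists p; apply/asymptotic_centerE => // z.
apply: le_trans (r_le z).
have sqrt_le : Num.sqrt (sq_radius s p) <= Num.sqrt r.
  apply/ler_addgt0Pr => e e0.
  have rs0 : 0 <= Num.sqrt r by exact: sqrtr_ge0.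
  rewrite -[leRHS]ger0_norm; last by lra.
  rewrite -sqrtr_sqr ler_sqrt ?sqr_ge0//.
  have e20 : 0 < (Num.sqrt r + e / 2) ^+ 2 - r.
    by rewrite -[X in _ - X](sqr_sqrtr r0); nra.
  have [n [yn pyn]] : exists n, sq_radius s (y n) < (Num.sqrt r + e / 2) ^+ 2
      /\ mdist p (y n) < e / 2.
    have e2 : 0 < e / 2 by lra.
    have h1 := y_near _ e20.
    have h2 : \forall n \near \oo, mdist p (y n) < e / 2.
      exact: metricType_numDomainType.cvgr_dist_lt.
    have [n [yn pyn]] := filter_ex (filterI h1 h2).
    by exists n; split=> //; move: yn; rewrite addrC subrK.
  apply: sq_radius_le_near => //.
  apply: filterS (sq_radius_near_lt _ _ _ bs _ yn) => [k|]; last by lra.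
  by have := metric_triangle p (y n) (s k); lra.
by move: sqrt_le; rewrite ler_sqrt.
Unshelve. all: by end_near. Qed.

End Hadamard.

(** * Orbits of nonspreading mappings *)

Section Nonspreading.
Context {R : realType} {X : metricType R}.
Implicit Types (x y z p : X) (s : nat -> X) (T : X -> X).

Lemma nonspreading_quasi_nonexpansive T p x : metrically_nonspreading T ->
  fixed_points T p -> mdist p (T x) <= mdist p x.
Proof.
move=> nsT pT; rewrite -(@ler_pXn2r _ 2)// ?nnegrE ?mdist_ge0//.
by have := nsT p x; rewrite pT (metric_sym _ p); lra.
Qed.

Lemma iter_mdist_nonincreasing T p x : metrically_nonspreading T ->
  fixed_points T p -> nonincreasing_seq (fun n => mdist p (iter n T x)).
Proof.
move=> nsT pT; apply/nonincreasing_seqP => n.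
exact: (nonspreading_quasi_nonexpansive T p (iter n T x)).
Qed.

Lemma iter_bounded T p x : metrically_nonspreading T ->
  fixed_points T p -> metric_bounded (fun n => iter n T x).
Proof.
move=> nsT pT; exists p, (mdist p x) => n.
exact: (iter_mdist_nonincreasing T p x nsT pT 0%N n).
Qed.

(** The upper limits of d(x_n, x_(n+k))^2 form a bounded convex sequence in k
starting at 0, hence vanish at k = 1. *)
Lemma iter_asymptotically_regular T p x : metrically_nonspreading T ->
  fixed_points T p ->
  mdist (iter n T x) (iter n.+1 T x) @[n --> \oo] --> (0 : R).
Proof.
move=> nsT pT; pose d (k n : nat) := mdist (iter n T x) (iter (n + k) T x) ^+ 2.
pose M := (2 * mdist p x) ^+ 2.
have dM k n : 0 <= d k n <= M.
  rewrite sqr_ge0 lerXn2r// ?nnegrE ?mulr_ge0 ?mdist_ge0//.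
  have := metric_triangle (iter n T x) p (iter (n + k) T x).
  have := iter_mdist_nonincreasing T p x nsT pT 0%N n isT.
  have := iter_mdist_nonincreasing T p x nsT pT 0%N (n + k)%N isT.
  by rewrite (metric_sym _ p) /=; lra.
have bd k : bounded_fun (d k : nat -> R^o) by apply: bounded_fun_itv (dM k).
have D1 : limn_sup (d 1%N) <= 0.
  apply: (convex_bounded_step0 _ (fun k => limn_sup (d k)) M) => [|k|k].
  - have -> : d 0%N = cst 0 by apply/funext => n; rewrite /d addn0 mdistxx expr0n.
    by have /cvg_limn_inf_sup[_ ->] : cst 0 @ \oo --> (0 : R^o) by exact: cvg_cst.
  - rewrite -[X in X + _](limn_sup_shift _ _ (bd k)).
    (* The distances giving D_(k+1) and D_k start at T x_n = x_(n+1), hence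
       the shift by one; the one giving D_(k+2) starts at x_n. *)
    have := limn_sup_midpoint _ (fun n => d k.+1 n.+1) (fun n => d k n.+1) (d k.+2) 0.
    rewrite limn_sup_shift// addr0; apply => //.
    + exact: bounded_fun_itv (fun n => dM k.+1 n.+1).
    + exact: bounded_fun_itv (fun n => dM k n.+1).
    + apply: nearW => n; rewrite addr0 /d.
      have := nsT (iter n T x) (iter (n + k.+1) T x).
      rewrite (metric_sym _ (iter n T x)) -!iterS !addnS !addSn; exact.
  - by apply: limn_sup_le_near => //; apply: nearW => n; case/andP: (dM k n).
apply/cvgrPdist_lt => e e0.
have := limn_sup_near_lt _ (d 1%N) (e ^+ 2) (bd _) (le_lt_trans D1 (exprn_gt0 2 e0)).
apply: filterS => n; rewrite /d addn1 sub0r normrN ger0_norm ?mdist_ge0//.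
by rewrite ltr_pXn2r// nnegrE ?mdist_ge0// ltW.
Qed.

(** Asymptotically close sequences have the same radii; one inequality suffices,
the hypothesis being symmetric. *)
Lemma sq_radius_le_asymp s s' y : metric_bounded s -> metric_bounded s' ->
  mdist (s n) (s' n) @[n --> \oo] --> (0 : R) -> sq_radius s y <= sq_radius s' y.
Proof.
move=> bs bs' ss'; rewrite -ler_sqrt ?sq_radius_ge0//.
apply/ler_addgt0Pr => e e0.
have r0 : 0 <= Num.sqrt (sq_radius s' y) by exact: sqrtr_ge0.
rewrite -[leRHS]ger0_norm; last by lra.
rewrite -sqrtr_sqr ler_sqrt ?sqr_ge0//.
apply: sq_radius_le_near => //.
have e2 : 0 < e / 2 by lra.
have lt_r : sq_radius s' y < (Num.sqrt (sq_radius s' y) + e / 2) ^+ 2.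
  by rewrite -[ltLHS]sqr_sqrtr ?sq_radius_ge0//; nra.
have := sq_radius_near_lt _ _ _ bs' _ lt_r; rewrite addr_ge0 ?(ltW e2)// => /(_ isT).
move=> ys'; move/cvgrPdist_lt : ss' => /(_ _ e2) ss'.
apply: filterS2 ss' ys' => n; rewrite sub0r normrN ger0_norm ?mdist_ge0// => sn ys'.
by have := metric_triangle y (s' n) (s n); rewrite (metric_sym (s' n)); lra.
Qed.

(** The nonspreading inequality at z and s_n bounds the radius at T z by that at z,
once the radii along T o s and s are identified; uniqueness of the center then
gives T z = z. *)
Lemma regular_asymptotic_center_fixed T s z : CAT0 X -> metrically_nonspreading T ->
  metric_bounded s -> mdist (s n) (T (s n)) @[n --> \oo] --> (0 : R) ->
  asymptotic_center s z -> fixed_points T z.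
Proof.
move=> cat nsT bs reg sz.
have bTs : metric_bounded (T \o s).
  have [y [M sM]] := bs.
  have [B regB] : has_ubound (range (fun n => mdist (s n) (T (s n)) : R^o)).
    by apply: bounded_fun_has_ubound; apply: cvg_seq_bounded; apply/cvg_ex; exists 0.
  exists y, (M + B) => n; apply: le_trans (metric_triangle _ (s n) _) _.
  by rewrite lerD//; apply: regB; exists n.
apply: (asymptotic_center_unique s) => //.
apply/asymptotic_centerE => // y.
apply: le_trans (_ : sq_radius s z <= _); last by move/asymptotic_centerE : sz; exact.
have Tsz : sq_radius (T \o s) z <= sq_radius s z.
  apply: sq_radius_le_asymp => //.
  by under eq_fun do rewrite metric_sym.
have sTz : sq_radius s (T z) <= sq_radius (T \o s) (T z).
  exact: sq_radius_le_asymp.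
have : 2 * sq_radius (T \o s) (T z) + 0 <= sq_radius (T \o s) z + sq_radius s (T z).
  apply: limn_sup_midpoint; [exact: bounded_fun_sq_mdist..|].
  apply: nearW => n; rewrite addr0 /=.
  by have := nsT z (s n); rewrite (metric_sym _ z) addrC.
lra.
Qed.

Lemma increasing_seq_cvgn (phi : nat -> nat) : increasing_seq phi -> phi @ \oo --> \oo.
Proof.
move=> phi_incr A [N _ NA]; exists N => // n /= Nn; apply: NA => /=.
apply: (leq_trans Nn); elim: n {Nn} => // n IH; apply: leq_ltn_trans IH _.
by move/increasing_seqP : phi_incr => /(_ n).
Qed.

(** Distances from the orbit to a fixed point never increase, so they have a limit,
which every subsequence shares. *)
Lemma sq_radius_iter_sub T p x (phi : nat -> nat) : metrically_nonspreading T ->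
  fixed_points T p -> increasing_seq phi ->
  sq_radius ((fun n => iter n T x) \o phi) p = sq_radius (fun n => iter n T x) p.
Proof.
move=> nsT pT phi_incr; rewrite /sq_radius.
have : cvgn (fun n => mdist p (iter n T x) ^+ 2 : R^o).
  apply: nonincreasing_is_cvgn.
    move=> m n mn; rewrite lerXn2r ?nnegrE ?mdist_ge0//.
    exact: iter_mdist_nonincreasing.
  by exists 0 => _ [n _ <-]; exact: sqr_ge0.
move=> /[dup] ucvg /cvg_ex[l ul].
rewrite (cvg_limn_supE ucvg) (cvg_lim _ ul)//.
by case: (cvg_limn_inf_sup (cvg_comp _ _ (increasing_seq_cvgn _ phi_incr) ul)).
Qed.

End Nonspreading.
End proof.

Theorem theorem4p8 (R : realType) (X : metricType R) (T : X -> X)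
    (hX : Hadamard X) (hT : metrically_nonspreading T)
    (hF : fixed_points T !=set0) :
  forall x : X, exists2 p : X,
    fixed_points T p & delta_cvg (fun n : nat => iter n T x) p.
Proof.
move=> x; have [q qT] := hF; have cat := hX.2.
pose s n := iter n T x.
have bs : metric_bounded s := iter_bounded T q x hT qT.
have reg := iter_asymptotically_regular T q x hT qT.
have [p sp] := asymptotic_center_nonempty s hX bs.
have pT : fixed_points T p by exact: (regular_asymptotic_center_fixed _ s).
exists p => // phi phi_incr.
have bsphi : metric_bounded (s \o phi) by exact: metric_bounded_sub.
have regphi := cvg_comp _ _ (increasing_seq_cvgn _ phi_incr) reg.
have [c spc] := asymptotic_center_nonempty (s \o phi) hX bsphi.
have cT : fixed_points T c by exact: (regular_asymptotic_center_fixed _ (s \o phi)).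
(* Radii at the fixed points c and p may be taken along the orbit or along
   phi; c is optimal for the latter, hence as good as p for the former. *)
have sc : asymptotic_center s c.
  apply/asymptotic_centerE => // y.
  rewrite -(sq_radius_iter_sub T c x phi)//.
  apply: (@Order.POrderTheory.le_trans _ _ (sq_radius (s \o phi) p)).
    by move/asymptotic_centerE : spc; exact.
  rewrite (sq_radius_iter_sub T p x phi)//.
  by move/asymptotic_centerE : sp; exact.
have cp : c = p by exact: (asymptotic_center_unique s).
rewrite cp in spc.
apply/seteqP; split => [y spy|y ->//].
exact: (asymptotic_center_unique (s \o phi)).
Qed.
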